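(* Let $\mathcal{H}$ and $\mathcal{G}$ be real Hilbert spaces, let $L\colon\mathcal{H}\to\mathcal{G}$ be a bounded linear operator, let $B\colon\mathcal{G}\to 2^{\mathcal{G}}$ be a set-valued operator, and let $\gamma\in(0,+\infty)$. Then the following hold: (i) Suppose that $L$ is an isometry, i.e., $L^*\circ L=\mathrm{Id}_{\mathcal{H}}$. Then $L\overset{\gamma}{\diamond}B=L\overset{\gamma}{\bullet}B$. (ii) Suppose that $L$ is a coisometry, i.e., $L\circ L^*=\mathrm{Id}_{\mathcal{G}}$. Then $L\overset{\gamma}{\diamond}B=L^*\triangleright B$ and $L\overset{\gamma}{\bullet}B=L^*\circ B\circ L$. (iii) Suppose that $L$ is invertible with $L^{-1}=L^*$. Then $L\overset{\gamma}{\diamond}B=L^*\triangleright B=L^*\circ B\circ L=L\overset{\gamma}{\bullet}B$.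
   Context: For a set-valued operator $A$, $A^{-1}$ is defined by $x\in A^{-1}x^*\Leftrightarrow x^*\in Ax$. Single-valued maps are identified with set-valued ones; sums, scalar multiples and compositions are pointwise, e.g. $(L^*\circ C\circ L)x=\{L^*y\mid y\in C(Lx)\}$. For a bounded linear $L\colon\mathcal{H}\to\mathcal{G}$ with adjoint $L^*$ and $C\colon\mathcal{G}\to2^{\mathcal{G}}$, the parallel composition is $L^*\triangleright C=(L^*\circ C^{-1}\circ L)^{-1}\colon\mathcal{H}\to2^{\mathcal{H}}$. For $\gamma>0$, the resolvent composition is $L\overset{\gamma}{\diamond}C=L^*\triangleright(C+\gamma^{-1}\mathrm{Id}_{\mathcal{G}})-\gamma^{-1}\mathrm{Id}_{\mathcal{H}}\colon\mathcal{H}\to2^{\mathcal{H}}$, and the resolvent cocomposition is $L\overset{\gamma}{\bullet}C=(L\overset{1/\gamma}{\diamond}C^{-1})^{-1}\colon\mathcal{H}\to2^{\mathcal{H}}$. *)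

(* Defs.v *)
From HB Require Import structures.
From mathcomp Require Import all_boot all_order all_algebra.
From mathcomp Require Import all_classical all_reals all_analysis.

Set Implicit Arguments.
Unset Strict Implicit.
Unset Printing Implicit Defensive.

Import Order.TTheory GRing.Theory Num.Theory.
Import numFieldNormedType.Exports.

Local Open Scope classical_set_scope.
Local Open Scope ring_scope.

(* A real Hilbert space is a complete normed space whose norm is induced by an
   inner product; [{dot H for idfun}] is the type of positive definite symmetric
   bilinear forms on [H]. *)
HB.mixin Record CompleteNormedModule_isHilbert (R : realType) H
    of CompleteNormedModule R H := {
  inner : {dot H for idfun};
  inner_normE : forall x : H, inner x x = `|x| ^+ 2
}.

#[short(type="hilbertType")]
HB.structure Definition Hilbert (R : realType) :=
  {H of CompleteNormedModule R H & CompleteNormedModule_isHilbert R H}.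

(* The Hilbert adjoint. By positive definiteness at most one [x] qualifies, and
   by the Riesz representation theorem one does for every [y] when [L] is
   bounded; the default value [0] is then never used. *)
Definition adjoint (R : realType) (H G : hilbertType R) (L : {linear H -> G})
    (y : G) : H :=
  xget 0 [set x | forall z : H, inner (L z) y = inner z x].

(* A set-valued operator from [T] to [U] is a function [T -> set U]. *)

Definition op_inv (T U : Type) (A : T -> set U) : U -> set T :=
  fun u => [set x | A x u].

Definition op_add (T : Type) (U : zmodType) (A B : T -> set U) : T -> set U :=
  fun x => [set u + v | u in A x & v in B x].

Definition op_sub (T : Type) (U : zmodType) (A B : T -> set U) : T -> set U :=
  fun x => [set u - v | u in A x & v in B x].

Definition op_scaled_id (R : realType) (V : lmodType R) (c : R) : V -> set V :=
  fun x => [set c *: x].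

Section ResolventCompositions.
Variables (R : realType) (H G : hilbertType R) (L : {linear H -> G}).

(* L^* o C o L *)
Definition adjoint_comp (C : G -> set G) : H -> set H :=
  fun x => [set adjoint L y | y in C (L x)].

(* L^* |> C; the first argument is [L], its adjoint being taken inside. *)
Definition parallel_comp (C : G -> set G) : H -> set H :=
  op_inv (adjoint_comp (op_inv C)).

Definition resolvent_comp (gamma : R) (C : G -> set G) : H -> set H :=
  op_sub (parallel_comp (op_add C (op_scaled_id gamma^-1)))
         (op_scaled_id gamma^-1).

Definition resolvent_cocomp (gamma : R) (C : G -> set G) : H -> set H :=
  op_inv (resolvent_comp gamma^-1 (op_inv C)).

End ResolventCompositions.

(* Main.v *)
Require Import Defs.
From HB Require Import structures.
From mathcomp Require Import all_boot all_order all_algebra.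
From mathcomp Require Import all_classical all_reals all_analysis.
From mathcomp Require Import ring lra.

Import Order.TTheory GRing.Theory Num.Theory.
Import numFieldNormedType.Exports.

Local Open Scope classical_set_scope.
Local Open Scope ring_scope.

(* Everything reduces to explicit solution sets: [u] is in [L <>_gamma B] at [x]
   iff [x = L^* y] and [L (u + x / gamma) = b + y / gamma] for some [b] in [B y],
   and for the cocomposition [u = L^* b] and [L (x + gamma u) = y + gamma b] for
   such a pair. When [L^* L = Id], applying [L^*] to either equation recovers
   the missing adjoint identity, so both sets coincide; when [L L^* = Id], the
   first description collapses to [L u = b]. Part (i) needs [L^*] to be linear
   on all of [G], hence the Riesz representation theorem. *)

Section Inner.
Context {R : realType} {H : hilbertType R}.
Implicit Types x y z : H.

Lemma innerC x y : inner x y = inner y x.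
Proof. by rewrite hermC expr0 mul1r. Qed.

Lemma innerxx x : inner x x = `|x| ^+ 2.
Proof. exact: inner_normE. Qed.

Lemma innerDl x y z : inner (x + y) z = inner x z + inner y z.
Proof. exact: linearDl. Qed.

Lemma innerZl a x y : inner (a *: x) y = a * inner x y.
Proof. exact: linearZl_LR. Qed.

Lemma innerDr x y z : inner z (x + y) = inner z x + inner z y.
Proof. by rewrite innerC innerDl !(innerC z). Qed.

Lemma innerZr a x y : inner y (a *: x) = a * inner y x.
Proof. by rewrite innerC innerZl (innerC y). Qed.

Lemma sqr_normD x y : `|x + y| ^+ 2 = `|x| ^+ 2 + `|y| ^+ 2 + 2 * inner x y.
Proof. by rewrite -!innerxx innerDl !innerDr (innerC y x); ring. Qed.

Lemma inner_inj x y : (forall z, inner z x = inner z y) -> x = y.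
Proof.
move=> xy; apply/eqP; rewrite -subr_eq0 -normr_eq0 -sqrf_eq0 -innerxx.
by rewrite -scaleN1r innerDr innerZr xy mulN1r subrr.
Qed.

(** The norm already satisfies the triangle inequality; squaring and expanding it bounds the inner
    product above, and [- x] gives the lower bound. *)
Lemma cauchy_schwarz x y : `|inner x y| <= `|x| * `|y|.
Proof.
have le z : inner z y <= `|z| * `|y|.
  have : `|z + y| ^+ 2 <= (`|z| + `|y|) ^+ 2.
    by rewrite ler_sqr ?nnegrE ?addr_ge0// ler_normD.
  by rewrite sqr_normD sqrrD; lra.
rewrite ler_norml le andbT lerNl.
by have := le (- x); rewrite -scaleN1r innerZl mulN1r scaleN1r normrN.
Qed.

(* The representative is the minimiser of [J], whose minimising sequences are
   Cauchy by the parallelogram law. *)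
Lemma riesz_representation (f : {linear H -> R^o}) :
  bounded_near f (nbhs (0 : H)) -> exists x, forall z, f z = inner z x.
Proof.
move=> bf; have cf : continuous f by exact/linear_bounded_continuous.
have fD u v : f (u + v) = f u + f v by exact: linearD.
have fZ a u : f (a *: u) = a * f u by exact: linearZ.
have [M fM] : exists M : R, forall z, `|f z| <= M * `|z|.
  have /linear_boundedP/pinfty_ex_gt0[M _ fM] := bf.
  by exists M.
pose J z : R := `|z| ^+ 2 - 2 * f z.
pose m := inf (range J).
have J_has_inf : has_inf (range J).
  split; first by exists (J 0), 0.
  (* Completing the square in $|z|^2 - 2M|z|$ gives this bound. *)
  exists (- M ^+ 2) => _ [z _ <-]; rewrite /J.
  have := ler_norm (f z); have := fM z; have := sqr_ge0 (`|z| - M).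
  by rewrite sqrrB; lra.
have mJ z : m <= J z by apply: ge_inf; [case: J_has_inf|exists z].
(* The linear terms cancel, leaving the parallelogram law. *)
have J_parallelogram z w :
    `|z - w| ^+ 2 = 2 * J z + 2 * J w - 4 * J (2^-1 *: (z + w)).
  rewrite /J fZ fD normrZ exprMn !sqr_normD ger0_norm ?invr_ge0//.
  by rewrite normrN -scaleN1r innerZr; field.
have /choice[u_ uJ] (n : nat) : exists z, J z < m + n.+1%:R^-1.
  have [|_ [z _ <-] Jz] := @inf_adherent _ _ (n.+1%:R^-1 : R) _ J_has_inf.
    by rewrite invr_gt0.
  by exists z.
have u_cvg : cvg (u_ @ \oo).
  apply/cauchy_cvgP/cauchy_exP => e e0.
  (* If [J] is within $e^2/4$ of [m] at two points, the identity above and [mJ] at their midpoint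
     put them at distance less than [e]. *)
  have e40 : 0 < e ^+ 2 / 4 by rewrite divr_gt0// exprn_gt0.
  have [N _ /= harmN] := near_infty_natSinv_lt (PosNum e40).
  exists (u_ N), N => // n /= Nn.
  rewrite -ball_normE /= -ltr_sqr ?nnegrE ?(ltW e0)//.
  rewrite J_parallelogram.
  have := harmN _ (leqnn N); have := harmN _ Nn; have := uJ N; have := uJ n.
  have := mJ (2^-1 *: (u_ N + u_ n)).
  by move: (n.+1%:R^-1) (N.+1%:R^-1) => /= *; lra.
pose x := lim (u_ @ \oo).
have Jxm : J x <= m.
  have ux : u_ @ \oo --> x by exact: u_cvg.
  have Jux : J (u_ n) @[n --> \oo] --> J x.
    apply: cvgB; last by apply: cvgZr; apply: continuous_cvg; [exact: cf|].
    rewrite expr2; under eq_fun do rewrite expr2.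
    by apply: cvgM; apply: cvg_norm.
  have mh : m + harmonic n @[n --> \oo] --> m.
    rewrite -[X in _ --> X]addr0.
    by apply: cvgD; [exact: cvg_cst|exact: cvg_harmonic].
  by apply: (ler_cvg_to Jux mh); near=> n; exact/ltW/uJ.
exists x => w.
pose a := inner w x - f w; pose b := `|w| ^+ 2.
(* This is $J(x + tw) - J(x)$, nonnegative since [x] minimises [J]. *)
have ab t : 0 <= 2 * t * a + t ^+ 2 * b.
  have := le_trans Jxm (mJ (x + t *: w)).
  rewrite /J sqr_normD fD fZ normrZ exprMn real_normK ?num_real//.
  by rewrite innerZr (innerC x) /a /b; lra.
suff /eqP : a = 0 by rewrite subr_eq0 => /eqP ->.
have b0 : 0 <= b by exact: sqr_ge0.
have b10 : 0 < b + 1 by rewrite ltr_wpDl.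
(* The quadratic is least at $t = -a/b$; [b + 1] also covers $w = 0$ and still makes the value
   negative unless $a = 0$. *)
have := ab (- a / (b + 1)).
have -> : 2 * (- a / (b + 1)) * a + (- a / (b + 1)) ^+ 2 * b =
          - (a ^+ 2 * (b + 2) / (b + 1) ^+ 2) by field; rewrite gt_eqF.
rewrite oppr_ge0 pmulr_lle0 ?invr_gt0 ?exprn_gt0// pmulr_lle0 ?ltr_wpDl// => a2.
by apply/eqP; rewrite -sqrf_eq0 eq_le a2 sqr_ge0.
Unshelve. all: by end_near.
Qed.

End Inner.

Section Adjoint.
Context {R : realType} {H G : hilbertType R} (L : {linear H -> G}).
Hypothesis bL : bounded_near L (nbhs (0 : H)).

(** Cauchy-Schwarz bounds the functional $z \mapsto \langle Lz, y\rangle$, so by Riesz [xget] never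
    falls back on [0]. *)
Lemma adjointE z y : inner (L z) y = inner z (adjoint L y).
Proof.
have f_lin : linear (fun z => inner (L z) y : R^o).
  by move=> a u v /=; rewrite linearP innerDl innerZl.
pose f := GRing.isLinear.Build _ _ _ _ _ f_lin.
pose F : {linear H -> R^o} := HB.pack (fun z => inner (L z) y : R^o) f.
have bF : bounded_near F (nbhs (0 : H)).
  apply/linear_boundedP.
  have /linear_boundedP/pinfty_ex_gt0[M M0 LM] := bL.
  near=> r => u; apply: le_trans (cauchy_schwarz _ _) _.
  apply: (@le_trans _ _ (M * `|y| * `|u|)).
    by rewrite mulrAC ler_wpM2r.
  by rewrite ler_wpM2r//; near: r; apply: nbhs_pinfty_ge; exact: num_real.
have [x Fx] := riesz_representation F bF.
by have := xgetI 0 (Fx : [set x | forall z, inner (L z) y = inner z x] x); apply.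
Unshelve. all: by end_near.
Qed.

Lemma adjointD y y' : adjoint L (y + y') = adjoint L y + adjoint L y'.
Proof. by apply: inner_inj => z; rewrite innerDr -!adjointE// innerDr. Qed.

Lemma adjointZ a y : adjoint L (a *: y) = a *: adjoint L y.
Proof. by apply: inner_inj => z; rewrite innerZr -!adjointE// innerZr. Qed.

End Adjoint.

Section Compositions.
Context {R : realType} {H G : hilbertType R} (L : {linear H -> G}).
Implicit Types (B : G -> set G) (gamma : R) (x u : H).

(** For $\gamma^{-1}$ and $B^{-1}$ it describes the cocomposition, with [x], [u] and [y], [b]
    exchanged. *)
Lemma resolvent_compE gamma B x u :
  resolvent_comp L gamma B x u <->
  exists y b, [/\ B y b, adjoint L y = x &
                  L (u + gamma^-1 *: x) = b + gamma^-1 *: y].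
Proof.
split=> [[v [y [b Bb [_ -> Lv]] yx] [_ -> <-]]|[y [b [Bb yx Lv]]]].
  by exists y, b; rewrite subrK.
exists (u + gamma^-1 *: x); last by exists (gamma^-1 *: x); rewrite ?addrK.
by exists y => //; exists b => //; exists (gamma^-1 *: y).
Qed.

Lemma resolvent_comp_sub_cocomp gamma B x u :
  bounded_near L (nbhs (0 : H)) -> 0 < gamma -> adjoint L \o L = id ->
  resolvent_comp L gamma B x u -> resolvent_cocomp L gamma B x u.
Proof.
move=> bL gamma0 LL /resolvent_compE[y [b [Bb yx Lu]]].
have LK z : adjoint L (L z) = z := congr1 (@^~ z) LL.
apply/resolvent_compE; exists b, y; split=> //.
  (* Applying $L^*$ gives $u + \gamma^{-1}x = L^*b + \gamma^{-1}x$. *)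
  have /(congr1 (adjoint L)) := Lu.
  by rewrite LK adjointD// adjointZ// yx => /addIr.
rewrite invrK.
have -> : x + gamma *: u = gamma *: (u + gamma^-1 *: x).
  by rewrite scalerDr scalerA divff ?gt_eqF// scale1r addrC.
by rewrite linearZ /= Lu scalerDr scalerA divff ?gt_eqF// scale1r addrC.
Qed.

Lemma isometry_resolvent_comp gamma B :
  bounded_near L (nbhs (0 : H)) -> 0 < gamma -> adjoint L \o L = id ->
  resolvent_comp L gamma B = resolvent_cocomp L gamma B.
Proof.
move=> bL gamma0 LL; apply/funext => x; apply/seteqP; split=> u.
  exact: resolvent_comp_sub_cocomp.
move=> xu.
(* Passing to $\gamma^{-1}$ and $B^{-1}$ swaps the two compositions up to inversion, so the reverse
   inclusion is the same lemma. *)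
have := @resolvent_comp_sub_cocomp gamma^-1 (op_inv B) u x bL.
by rewrite invr_gt0 /resolvent_cocomp invrK; apply.
Qed.

Lemma coisometry_resolvent_comp gamma B :
  L \o adjoint L = id -> resolvent_comp L gamma B = parallel_comp L B.
Proof.
move=> LL; have LK y : L (adjoint L y) = y := congr1 (@^~ y) LL.
apply/funext => x; apply/seteqP; split=> u.
  move=> /resolvent_compE[y [b [Bb yx]]].
  (* As $Lx = LL^*y = y$, the terms $\gamma^{-1}y$ cancel. *)
  rewrite linearD linearZ -yx /= LK => /addIr Lu.
  by exists y => //; rewrite /op_inv /= Lu.
move=> [y By yx]; apply/resolvent_compE; exists y, (L u); split=> //.
by rewrite linearD linearZ -yx /= LK.
Qed.

Lemma coisometry_resolvent_cocomp gamma B :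
  L \o adjoint L = id -> resolvent_cocomp L gamma B = adjoint_comp L B.
Proof. by move=> LL; rewrite /resolvent_cocomp coisometry_resolvent_comp. Qed.

(** Here $x = L^*y$ means $y = Lx$, so both sides say $Lu \in B(Lx)$. *)
Lemma unitary_parallel_comp B :
  cancel L (adjoint L) -> cancel (adjoint L) L ->
  parallel_comp L B = adjoint_comp L B.
Proof.
move=> LK KL; apply/funext => x; apply/seteqP; split=> u.
  by move=> [y By <-]; exists (L u); rewrite ?LK// KL.
by move=> [y By <-]; exists (L x); rewrite ?LK// /op_inv /= KL.
Qed.

End Compositions.

Theorem proposition3p4 (R : realType) (H G : hilbertType R)
    (L : {linear H -> G}) (hL : bounded_near L (nbhs (0 : H)))
    (B : G -> set G) (gamma : R) (hgamma : 0 < gamma) :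
  (* (i) *)
  (adjoint L \o L = id ->
     resolvent_comp L gamma B = resolvent_cocomp L gamma B) /\
  (* (ii) *)
  (L \o adjoint L = id ->
     resolvent_comp L gamma B = parallel_comp L B /\
     resolvent_cocomp L gamma B = adjoint_comp L B) /\
  (* (iii) *)
  (cancel L (adjoint L) -> cancel (adjoint L) L ->
     [/\ resolvent_comp L gamma B = parallel_comp L B,
         parallel_comp L B = adjoint_comp L B &
         adjoint_comp L B = resolvent_cocomp L gamma B]).
Proof.
split; first exact: isometry_resolvent_comp.
split=> [LL|LK KL].
  by rewrite coisometry_resolvent_comp// coisometry_resolvent_cocomp.
have LL : L \o adjoint L = id by apply/funext => y; exact: KL.
rewrite coisometry_resolvent_comp// coisometry_resolvent_cocomp//.
by rewrite unitary_parallel_comp.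
Qed.
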